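(* Let $\gamma$ be an $\mathbb S_{\mathrm{III}}$-plane. The set of all fixed-III-planes that meet $\gamma$ forms one system of ruling planes of a Segre variety $\mathcal S_{2;2}$ in $\mathrm{PG}(8,q)$.
   Context: Let $q>2$ be a prime power. Let $\phi$ be a collineation of $\mathrm{PG}(2,q^3)$ of order 3 fixing pointwise an $\mathbb F_q$-subplane $\mathcal P_{2,q}$. A point $\bar P$ of $\mathrm{PG}(2,q^3)$ has Type III if $\bar P,\bar P^\phi,\bar P^{\phi^2}$ are non-collinear. Bose representation: identifying $\mathbb F_{q^3}^3$ with $\mathbb F_q^9$, each point $\bar P$ corresponds to a plane $[\![P]\!]$ of $\mathrm{PG}(8,q)$; it is an $\mathbb S_{\mathrm{III}}$-plane if $\bar P$ has Type III, and its points are III-points. $\phi$ induces a projectivity $\sigma$ of $\mathrm{PG}(8,q)$ of order 3 with $[\![P]\!]^\sigma=[\![P^\phi]\!]$. A fixed-III-plane is a $\sigma$-fixed plane containing at least one III-point. $\mathcal S_{2;2}$ denotes the Segre variety of $\mathrm{PG}(2,q)\times\mathrm{PG}(2,q)$ in $\mathrm{PG}(8,q)$, which has two systems of $q^2+q+1$ ruling planes. *)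

(* Defs.v *)
From HB Require Import structures.
From mathcomp Require Import all_boot all_order all_algebra all_field.
Set Implicit Arguments.
Unset Strict Implicit.
Unset Printing Implicit Defensive.
Import GRing.Theory.
Local Open Scope ring_scope.

Definition pgpoint (F : fieldType) (V : vectType F) : Type :=
  {U : {vspace V} | \dim U == 1%N}.

Section ProjectiveSpace.
Variables (F : fieldType) (V : vectType F).
Implicit Types (P Q R X : pgpoint V) (phi : pgpoint V -> pgpoint V).

Definition collinear P Q R : Prop :=
  exists L : {vspace V},
    [/\ \dim L = 2%N, (val P <= L)%VS, (val Q <= L)%VS & (val R <= L)%VS].

Definition collineation phi : Prop :=
  bijective phi /\
  (forall L : {vspace V}, \dim L = 2%N ->
     exists2 L' : {vspace V}, \dim L' = 2%N &
       forall P, (val (phi P) <= L')%VS = (val P <= L)%VS).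

Definition typeIII phi P : Prop := ~ collinear P (phi P) (phi (phi P)).

End ProjectiveSpace.

Definition has_order (T : Type) (n : nat) (f : T -> T) : Prop :=
  [/\ (0 < n)%N, iter n f =1 id &
      forall k : nat, (0 < k < n)%N -> ~ (iter k f =1 id)].

Section Bose.
Variables (F : finFieldType) (K : fieldExtType F).

(* S is the image of the points of PG(2,K) with coordinates in F under the
   projectivity of matrix b. *)
Definition subplane (S : pgpoint 'rV[K]_3 -> Prop) : Prop :=
  exists2 b : 'M[K]_3, b \in unitmx &
    forall P : pgpoint 'rV[K]_3,
      S P <-> exists2 x : 'rV[F]_3, x != 0 &
                val P = <[map_mx (in_alg K) x *m b]>%VS.

Variable theta : 'rV[F]_9 -> 'rV[K]_3.

Definition identification : Prop :=
  bijective theta /\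
  (forall (a : F) (y z : 'rV[F]_9),
     theta (a *: y + z) = (a%:A : K) *: theta y + theta z).

Definition bose (P : pgpoint 'rV[K]_3) : {vspace 'rV[F]_9} :=
  <<enum [pred y : 'rV[F]_9 | theta y \in val P]>>%VS.

(* The spanning family is already a subspace. *)
Lemma mem_bose (P : pgpoint 'rV[K]_3) (y : 'rV[F]_9) :
  identification -> (y \in bose P) = (theta y \in val P).
Proof.
move=> [_ thetaL]; apply/idP/idP=> [/coord_span ->|Py]; last first.
  by rewrite memv_span ?mem_enum.
have theta0 : theta 0 = 0.
  have := thetaL 1 0 0; rewrite !scale1r addr0 => /eqP.
  by rewrite -subr_eq subrr eq_sym => /eqP.
elim/big_rec: _ => [|i z _ Pz]; first by rewrite theta0 mem0v.
rewrite thetaL memvD // memvZ //.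
have : (i < size (enum [pred u : 'rV[F]_9 | theta u \in val P]))%N.
  by rewrite -cardE.
by move/(mem_nth 0); rewrite mem_enum.
Qed.

Variable phi : pgpoint 'rV[K]_3 -> pgpoint 'rV[K]_3.

Definition SIII_plane (U : {vspace 'rV[F]_9}) : Prop :=
  exists2 P : pgpoint 'rV[K]_3, typeIII phi P & U = bose P.

Definition III_point (X : pgpoint 'rV[F]_9) : Prop :=
  exists2 U : {vspace 'rV[F]_9}, SIII_plane U & (val X <= U)%VS.

(* The linear bijection g represents a projectivity sigma of PG(8,F). The
   order is that of sigma acting on subspaces, so g ^+ 3 may be any scalar. *)
Definition bose_induced (g : 'End('rV[F]_9)) : Prop :=
  [/\ lker g = 0%VS,
      has_order 3 (fun U : {vspace 'rV[F]_9} => (g @: U)%VS) &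
      forall P : pgpoint 'rV[K]_3, (g @: bose P)%VS = bose (phi P)].

Definition fixed_III_plane (g : 'End('rV[F]_9)) (U : {vspace 'rV[F]_9}) :
    Prop :=
  [/\ \dim U = 3%N, (g @: U)%VS = U &
      exists2 X : pgpoint 'rV[F]_9, III_point X & (val X <= U)%VS].

End Bose.

Section Segre.
Variable F : fieldType.
Implicit Types (h : 'Hom('M[F]_3, 'rV[F]_9)) (U : {vspace 'rV[F]_9}).
Implicit Types (S : pgpoint 'rV[F]_9 -> Prop).

(* The coordinates x_i y_j of the Segre embedding of PG(2,F) x PG(2,F) form
   the matrix x^T *m y; h is a choice of coordinates of PG(8,F). *)
Definition segre_map h (x y : 'rV[F]_3) : {vspace 'rV[F]_9} :=
  <[h (x^T *m y)]>%VS.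

Definition segre_param h S : Prop :=
  lker h = 0%VS /\
  (forall X, S X <-> exists x y : 'rV[F]_3,
     [/\ x != 0, y != 0 & val X = segre_map h x y]).

Definition segre_variety S : Prop := exists h, segre_param h S.

(* The points of U are the image of {<x>} x PG(2,F). *)
Definition ruling_plane1 h U : Prop :=
  exists2 x : 'rV[F]_3, x != 0 &
    forall X : pgpoint 'rV[F]_9,
      (val X <= U)%VS <-> exists2 y, y != 0 & val X = segre_map h x y.

(* The points of U are the image of PG(2,F) x {<y>}. *)
Definition ruling_plane2 h U : Prop :=
  exists2 y : 'rV[F]_3, y != 0 &
    forall X : pgpoint 'rV[F]_9,
      (val X <= U)%VS <-> exists2 x, x != 0 & val X = segre_map h x y.

Definition ruling_system S (Sys : {vspace 'rV[F]_9} -> Prop) : Prop :=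
  exists2 h, segre_param h S &
    (forall U, Sys U <-> ruling_plane1 h U) \/
    (forall U, Sys U <-> ruling_plane2 h U).

End Segre.

(* Main.v *)
(** Let [gamma] be the Bose plane of the Type III point [P].  The planes
    [gamma], [sigma gamma], [sigma^2 gamma] are the Bose planes of [P], [phi P],
    [phi (phi P)], which are independent over [K]; hence
    [F^9 = gamma (+) sigma gamma (+) sigma^2 gamma], and
    [w (x) y |-> y_0 w + y_1 sigma w + y_2 sigma^2 w] is a linear isomorphism
    from [gamma (x) F^3] onto [F^9].  A [sigma]-fixed plane meeting [gamma] in
    [<w>] contains the independent vectors [w], [sigma w], [sigma^2 w], so it is
    their span [krylov sigma 3 w], i.e. the image of [w (x) F^3].  Conversely
    such a span is [sigma]-fixed because [sigma^3] fixes every point. *)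
Require Import Defs.
From HB Require Import structures.
From mathcomp Require Import all_boot all_order all_algebra all_field.
Set Implicit Arguments.
Unset Strict Implicit.
Unset Printing Implicit Defensive.
Import GRing.Theory.
Local Open Scope ring_scope.

Lemma exists_lfun_of_linear (F : fieldType) (U V : vectType F) (f : U -> V) :
  linear f -> exists g : 'Hom(U, V), g =1 f.
Proof.
move=> f_linear.
pose fL : {linear U -> V} :=
  HB.pack f (GRing.isLinear.Build _ _ _ _ f f_linear).
by exists (linfun fL) => u; rewrite lfunE.
Qed.

Section Subspaces.
Variables (F : fieldType) (V : vectType F).
Implicit Types U : {vspace V}.

Lemma directv_sumS (I : finType) (Us Vs : I -> {vspace V}) :
  (forall i, Us i <= Vs i)%VS ->
  directv (\sum_i Vs i) -> directv (\sum_i Us i).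
Proof.
move=> sUV /directv_sum_independent indepV.
apply/directv_sum_independent => u Uu; apply: indepV => i _.
exact: subvP (sUV i) _ (Uu i isT).
Qed.

Lemma exists_supspace_dim U n :
  (\dim U <= n <= \dim {:V})%N ->
  exists2 L : {vspace V}, \dim L = n & (U <= L)%VS.
Proof.
move=> /andP[leUn lenV]; pose X := take (n - \dim U) (vbasis U^C).
have dX : \dim <<X>> = (n - \dim U)%N.
  have /catl_free/eqP-> : free (X ++ drop (n - \dim U) (vbasis U^C)).
    by rewrite cat_take_drop (basis_free (vbasisP _)).
  by rewrite size_takel // size_tuple dimv_compl leq_sub2r.
exists (U + <<X>>)%VS; last exact: addvSl.
rewrite dimv_disjoint_sum ?dX ?subnKC //; apply/eqP; rewrite -subv0.
by rewrite -(capv_compl U) capvS //; apply/span_subvP => u /mem_take/vbasis_mem.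
Qed.

Lemma exists_rV_param U n :
  \dim U = n -> exists2 W : 'Hom('rV[F]_n, V), lker W == 0%VS & limg W = U.
Proof.
move <-; have [coords coords_linear [vec coordsK vecK]] := subvs_vect_iso U.
have [|W WE] := @exists_lfun_of_linear F 'rV_(\dim U) V (vsval \o vec).
  move=> a x y /=; rewrite -linearP; congr (vsval _).
  by apply: (can_inj coordsK); rewrite coords_linear !vecK.
exists W.
  by apply/lker0P => x y; rewrite !WE => /subvs_inj/(can_inj vecK).
apply/vspaceP => u; apply/memv_imgP/idP => [[x _ ->] | Uu].
  by rewrite WE subvsP.
by exists (coords (vsproj U u)); rewrite ?memvf // WE /= coordsK vsprojK.
Qed.

Lemma lker0_limg_subv_eq (g : 'End(V)) U :
  lker g == 0%VS -> (g @: U <= U)%VS -> (g @: U)%VS = U.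
Proof.
by move=> /eqP g0 gU; apply/eqP; rewrite eqEdim gU limg_dim_eq ?g0 ?capv0 /=.
Qed.

End Subspaces.

Section ProjectivePoints.
Variables (F : fieldType) (V : vectType F).
Implicit Types (U : {vspace V}) (X : pgpoint V).

Lemma pgpoint_vline X : exists2 v, v != 0 & val X = <[v]>%VS.
Proof.
have dX := eqP (valP X).
have v0 : vpick (val X) != 0 by rewrite vpick0 -dimv_eq0 dX.
exists (vpick (val X)) => //; apply/eqP.
by rewrite eq_sym eqEdim dX dim_vline v0 -memvE memv_pick.
Qed.

Lemma exists_pgpoint_vline v : v != 0 -> exists X, val X = <[v]>%VS.
Proof.
move=> v0; have dv : \dim <[v]> == 1%N by rewrite dim_vline v0.
by exists (exist _ <[v]>%VS dv).
Qed.

Lemma eq_vspace_pgpoint U U' :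
  (forall X, (val X <= U)%VS <-> (val X <= U')%VS) -> U = U'.
Proof.
move=> UU'; apply/vspaceP => u.
have [-> | /exists_pgpoint_vline[X XE]] := eqVneq u 0; first by rewrite !mem0v.
by rewrite !memvE -XE; apply/idP/idP => /UU'.
Qed.

Lemma noncollinear_directv (P : 'I_3 -> pgpoint V) :
  (2 <= \dim {:V})%N -> ~ collinear (P 0) (P 1) (P 2) ->
  directv (\sum_i val (P i)).
Proof.
move=> dV ncol; rewrite directvEgeq /=.
under eq_bigr => i _ do rewrite (eqP (valP (P i))).
rewrite sum_nat_const card_ord muln1 leqNgt; apply/negP => dU; apply: ncol.
have [|L dL sUL] := @exists_supspace_dim _ _ (\sum_i val (P i))%VS 2.
  by rewrite -ltnS dU.
by exists L; split=> //; apply: subv_trans sUL; apply: (sumv_sup _).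
Qed.

End ProjectivePoints.

Section Iterates.
Variables (F : fieldType) (V : vectType F) (g : 'End(V)).
Implicit Types (U L : {vspace V}) (w : V).

Lemma iter_limg_vline n w :
  iter n (fun U => g @: U)%VS <[w]>%VS = <[iter n g w]>%VS.
Proof. by elim: n => //= n ->; rewrite limg_line. Qed.

Lemma memv_iter_limg n U w :
  w \in U -> iter n g w \in iter n (fun U => g @: U)%VS U.
Proof. by move=> Uw; elim: n => //= n; apply: memv_img. Qed.

Lemma lker0_iter_eq0 n w : lker g == 0%VS -> (iter n g w == 0) = (w == 0).
Proof.
by move=> /eqP g_inj; elim: n => //= n <-; rewrite -memv_ker g_inj memv0.
Qed.

Definition krylov n w : {vspace V} := (\sum_(j < n) <[iter j g w]>)%VS.

Lemma mem_krylov n w j : (j < n)%N -> iter j g w \in krylov n w.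
Proof. by move=> ltjn; rewrite memvE (sumv_sup (Ordinal ltjn)). Qed.

Lemma krylov_subv n w U : (g @: U <= U)%VS -> w \in U -> (krylov n w <= U)%VS.
Proof.
move=> gU Uw; apply/subv_sumP => j _; rewrite -memvE.
by elim: (val j) => //= i /(memv_img g)/(subvP gU).
Qed.

Lemma limg_krylov_subv n w :
  iter n g w \in krylov n w -> (g @: krylov n w <= krylov n w)%VS.
Proof.
move=> wn; rewrite {1}/krylov limg_sum; apply/subv_sumP => -[j ltjn] _ /=.
rewrite limg_line -iterS -memvE.
by move: ltjn; rewrite leq_eqVlt => /predU1P[-> // | /mem_krylov].
Qed.

Definition direct_iterates n U : bool :=
  directv (\sum_(j < n) iter j (fun U => g @: U)%VS U).

Variables (n : nat) (U : {vspace V}).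
Hypotheses (g_inj : lker g == 0%VS) (U_direct : direct_iterates n U).

Lemma direct_iterates_sum_eq0 (w : 'I_n -> V) :
  (forall j, w j \in U) -> \sum_(j < n) iter j g (w j) = 0 -> forall j, w j = 0.
Proof.
move=> Uw w0 j; apply/eqP; rewrite -(lker0_iter_eq0 j _ g_inj); apply/eqP.
pose gw (j : 'I_n) := iter j g (w j).
apply: (directv_sum_independent U_direct gw) => // i _; exact: memv_iter_limg.
Qed.

Lemma dim_krylov w : w \in U -> w != 0 -> \dim (krylov n w) = n.
Proof.
move=> Uw w0; have: directv (\sum_(j < n) <[iter j g w]>).
  by apply: directv_sumS U_direct => j; rewrite -memvE memv_iter_limg.
move/directvP => /= ->; under eq_bigr do rewrite dim_vline lker0_iter_eq0 // w0.
by rewrite sum_nat_const card_ord muln1.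
Qed.

Lemma fixed_meet_krylovP L :
  (0 < n)%N -> (forall w, w \in U -> iter n g w \in <[w]>%VS) ->
  [/\ \dim L = n, (g @: L)%VS = L & (L :&: U)%VS <> 0%VS] <->
  exists w, [/\ w \in U, w != 0 & L = krylov n w].
Proof.
move=> n_gt0 gn; split=> [[dL gL /eqP LU0] | [w [Uw w0 ->]]].
  have /memv_capP[Lw Uw] := memv_pick (L :&: U); set w := vpick _ in Lw Uw.
  have w0 : w != 0 by rewrite vpick0.
  exists w; split=> //; apply/eqP; rewrite eq_sym eqEdim dL dim_krylov // leqnn.
  by rewrite krylov_subv ?gL.
have wK : w \in krylov n w by apply: (@mem_krylov n w 0).
split; first exact: dim_krylov.
- apply/lker0_limg_subv_eq/limg_krylov_subv => //.
  by have /vlineP[a ->] := gn w Uw; rewrite memvZ.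
- by move=> /vspaceP/(_ w); rewrite memv_cap wK Uw memv0 (negPf w0).
Qed.

End Iterates.

Section SegreSlices.
Variables (F : fieldType) (V : vectType F) (m n : nat).
Implicit Types (h : 'Hom('M[F]_(m, n), V)) (x : 'rV[F]_m) (y : 'rV[F]_n).

Definition segre_slice h x : {vspace V} := limg (h \o linfun (mulmx x^T))%VF.

Lemma mem_segre_slice h x v :
  reflect (exists y, v = h (x^T *m y)) (v \in segre_slice h x).
Proof.
apply: (iffP memv_imgP) => [[y _ ->] | [y ->]]; exists y; rewrite ?memvf //;
  by rewrite comp_lfunE lfunE.
Qed.

Lemma pgpoint_segre_sliceP h x (X : pgpoint V) :
  (val X <= segre_slice h x)%VS <->
  exists2 y, y != 0 & val X = <[h (x^T *m y)]>%VS.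
Proof.
split=> [|[y _ ->]]; last by rewrite -memvE; apply/mem_segre_slice; exists y.
have [v v0 ->] := pgpoint_vline X.
rewrite -memvE => /mem_segre_slice[y vE]; exists y; last by rewrite -vE.
by apply: contra_neq v0 => y0; rewrite vE y0 mulmx0 linear0.
Qed.

End SegreSlices.

Section TensorOrbit.
Variables (F : fieldType) (V : vectType F) (m n : nat).
Variables (g : 'End(V)) (W : 'Hom('rV[F]_m, V)).
Implicit Types (x : 'rV[F]_m) (y : 'rV[F]_n) (L : {vspace V}).

Definition tensor_orbit : 'Hom('M[F]_(m, n), V) :=
  (\sum_(j < n) (iter j (comp_lfun g) W \o (linfun (row j) \o linfun trmx)))%VF.

Lemma tensor_orbitE M : tensor_orbit M = \sum_(j < n) iter j g (W (row j M^T)).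
Proof.
rewrite sum_lfunE; apply: eq_bigr => j _; rewrite !comp_lfunE !lfunE.
by elim: (val j) => //= i <-; rewrite comp_lfunE.
Qed.

Lemma tensor_orbit_mul x y :
  tensor_orbit (x^T *m y) = \sum_(j < n) y 0 j *: iter j g (W x).
Proof.
rewrite tensor_orbitE; apply: eq_bigr => j _.
have -> : row j (x^T *m y)^T = y 0 j *: x.
  by apply/rowP => i; rewrite !mxE big_ord1 !mxE mulrC.
by elim: (val j) => [|i IHi]; rewrite ?iterS ?IHi linearZ.
Qed.

Lemma lker0_tensor_orbit :
  lker g == 0%VS -> lker W == 0%VS -> direct_iterates g n (limg W) ->
  lker tensor_orbit == 0%VS.
Proof.
move=> g_inj W_inj W_direct; rewrite -subv0; apply/subvP => M.
rewrite memv_ker tensor_orbitE memv0 => /eqP M0.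
have W0 : forall j, W (row j M^T) = 0.
  pose w j := W (row j M^T).
  apply: (direct_iterates_sum_eq0 g_inj W_direct (w := w)) => // j.
  by rewrite memv_img ?memvf.
apply/eqP/trmx_inj/row_matrixP => j; rewrite trmx0 row0; apply/eqP.
by rewrite -memv0 -(eqP W_inj) memv_ker W0.
Qed.

Lemma segre_slice_tensor_orbit x :
  segre_slice tensor_orbit x = krylov g n (W x).
Proof.
apply/eqP; rewrite eqEsubv; apply/andP; split.
  apply/subvP => _ /mem_segre_slice[y ->]; rewrite tensor_orbit_mul.
  by apply: memv_suml => j _; rewrite memvZ ?mem_krylov.
apply/subv_sumP => j _; rewrite -memvE; apply/mem_segre_slice.
exists (delta_mx 0 j); rewrite tensor_orbit_mul (bigD1 j) //= mxE !eqxx scale1r.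
by rewrite big1 ?addr0 // => i /negPf ij; rewrite mxE ij scale0r.
Qed.

Lemma fixed_meet_segre_sliceP L :
  lker g == 0%VS -> lker W == 0%VS -> direct_iterates g n (limg W) ->
  (0 < n)%N -> (forall w, w \in limg W -> iter n g w \in <[w]>%VS) ->
  [/\ \dim L = n, (g @: L)%VS = L & (L :&: limg W)%VS <> 0%VS] <->
  exists2 x, x != 0 & L = segre_slice tensor_orbit x.
Proof.
move=> g_inj /eqP W_inj W_direct n_gt0 gn.
apply: iff_trans (fixed_meet_krylovP g_inj W_direct L n_gt0 gn) _.
have W_eq0 x : (W x == 0) = (x == 0) by rewrite -memv_ker W_inj memv0.
split=> [[_ [/memv_imgP[x _ ->]]] | [x x0 ->]].
  by rewrite W_eq0 => x0 ->; exists x; rewrite ?segre_slice_tensor_orbit.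
by exists (W x); rewrite memv_img ?memvf // W_eq0 segre_slice_tensor_orbit.
Qed.

End TensorOrbit.

Lemma ruling_plane1P (F : fieldType) (h : 'Hom('M[F]_3, 'rV[F]_9)) U :
  ruling_plane1 h U <-> exists2 x, x != 0 & U = segre_slice h x.
Proof.
split=> -[x x0 Ux]; exists x => //; last first.
  by rewrite Ux => X; apply: pgpoint_segre_sliceP.
apply: eq_vspace_pgpoint => X; apply: iff_trans (Ux X) _.
exact: iff_sym (pgpoint_segre_sliceP h x X).
Qed.

Section BosePlanes.
Variables (F : finFieldType) (K : fieldExtType F).
Variables (theta : 'rV[F]_9 -> 'rV[K]_3) (htheta : identification theta).
Implicit Types (P : pgpoint 'rV[K]_3) (U gamma : {vspace 'rV[F]_9}).

Lemma identificationD : {morph theta : y z / y + z}.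
Proof. by move=> y z; have := htheta.2 1 y z; rewrite !scale1r. Qed.

Lemma identification0 : theta 0 = 0.
Proof. by apply: (addrI (theta 0)); rewrite -identificationD !addr0. Qed.

Lemma dim_bose P : \dim (bose theta P) = \dim {:K}.
Proof.
have [[theta_inv thetaK theta_invK] thetaZD] := htheta.
have [v v0 PE] := pgpoint_vline P.
have [|f fE] :=
  @exists_lfun_of_linear F K 'rV[F]_9 (fun k => theta_inv (k *: v)).
  move=> a k l; apply: (can_inj thetaK).
  by rewrite thetaZD !theta_invK scalerA -scalerDl mulr_algl.
have f_inj : lker f = 0%VS.
  apply/eqP/lker0P => k l; rewrite !fE => /(can_inj theta_invK)/eqP.
  by rewrite -subr_eq0 -scalerBl scaler_eq0 (negPf v0) orbF subr_eq0 => /eqP.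
rewrite -(limg_dim_eq (f := f)) ?f_inj ?capv0 //; congr (\dim _).
apply/vspaceP => y; rewrite mem_bose // PE; apply/vlineP/memv_imgP.
  by move=> [k yE]; exists k; rewrite ?memvf // fE -yE thetaK.
by move=> [k _ ->]; exists k; rewrite fE theta_invK.
Qed.

Lemma bose_directv (I : finType) (P : I -> pgpoint 'rV[K]_3) :
  directv (\sum_i val (P i)) -> directv (\sum_i bose theta (P i)).
Proof.
have [theta_inj theta0] := (bij_inj htheta.1, identification0).
move=> /directv_sum_independent indepP.
apply/directv_sum_independent => u Pu u0 i _; apply: theta_inj; rewrite theta0.
apply: (indepP (theta \o u)) => // [j _ | ]; first by rewrite -mem_bose ?Pu.
by rewrite -(big_morph theta identificationD theta0) u0.
Qed.

Variables (phi : pgpoint 'rV[K]_3 -> pgpoint 'rV[K]_3).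
Variables (sigma : 'End('rV[F]_9)).

Lemma iter_limg_bose n P :
  bose_induced theta phi sigma ->
  iter n (fun U => sigma @: U)%VS (bose theta P) = bose theta (iter n phi P).
Proof. by move=> [_ _ sigma_bose]; elim: n => //= n ->; rewrite sigma_bose. Qed.

Lemma SIII_plane_direct_iterates gamma :
  bose_induced theta phi sigma -> SIII_plane theta phi gamma ->
  direct_iterates sigma 3 gamma.
Proof.
move=> hsigma [P typeP ->].
apply: (directv_sumS (Vs := fun j : 'I_3 => bose theta (iter j phi P))) => [j|].
  by rewrite iter_limg_bose.
apply/bose_directv/noncollinear_directv; last exact: typeP.
by rewrite dimvf.
Qed.

Lemma fixed_III_plane_meetP gamma U :
  SIII_plane theta phi gamma ->
  fixed_III_plane theta phi sigma U /\ (U :&: gamma)%VS <> 0%VS <->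
  [/\ \dim U = 3%N, (sigma @: U)%VS = U & (U :&: gamma)%VS <> 0%VS].
Proof.
move=> hgamma; split=> [[[dU sU _] U_meets] // | [dU sU U_meets]].
split=> //; split=> //; move/eqP: U_meets; rewrite -vpick0.
have /memv_capP[Uv gv] := memv_pick (U :&: gamma).
move=> /exists_pgpoint_vline[X XE]; exists X; last by rewrite XE -memvE.
by exists gamma; rewrite // XE -memvE.
Qed.

End BosePlanes.

Theorem theorem21 (F : finFieldType) (K : fieldExtType F)
  (hq : (2 < #|F|)%N) (hK : \dim {:K} = 3%N)
  (phi : pgpoint 'rV[K]_3 -> pgpoint 'rV[K]_3)
  (hphi : collineation phi) (hphi3 : has_order 3 phi)
  (P2q : pgpoint 'rV[K]_3 -> Prop) (hP2q : subplane P2q)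
  (hfix : forall P : pgpoint 'rV[K]_3, P2q P -> phi P = P)
  (theta : 'rV[F]_9 -> 'rV[K]_3) (htheta : identification theta)
  (sigma : 'End('rV[F]_9)) (hsigma : bose_induced theta phi sigma)
  (gamma : {vspace 'rV[F]_9}) (hgamma : SIII_plane theta phi gamma) :
  exists2 S : pgpoint 'rV[F]_9 -> Prop, segre_variety S &
    ruling_system S (fun U : {vspace 'rV[F]_9} =>
      fixed_III_plane theta phi sigma U /\ (U :&: gamma)%VS <> 0%VS).
Proof.
have [P _ gammaE] := hgamma; have [/eqP sigma_inj [_ sigma3 _] _] := hsigma.
have [|W W_inj limW] := @exists_rV_param _ _ gamma 3.
  by rewrite gammaE dim_bose.
have W_direct : direct_iterates sigma 3 (limg W).
  by rewrite limW; apply: SIII_plane_direct_iterates hsigma hgamma.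
pose h := tensor_orbit 3 sigma W.
have h_inj : lker h = 0%VS by apply/eqP/lker0_tensor_orbit.
pose S (X : pgpoint 'rV[F]_9) :=
  exists x y : 'rV[F]_3, [/\ x != 0, y != 0 & val X = segre_map h x y].
have hS : segre_param h S by split.
exists S; exists h => //; left=> U.
apply: iff_trans (fixed_III_plane_meetP _ _ hgamma) _; rewrite -limW.
apply: iff_trans (iff_sym (ruling_plane1P h U)).
apply: fixed_meet_segre_sliceP => // w _.
by rewrite memvE -iter_limg_vline sigma3.
Qed.
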